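(* Let $A$ be a symmetric Frobenius algebra and $X$ a direct sum of indecomposable non-projective $A$-modules. Let $M$ be an indecomposable $A$-module such that $\operatorname{Ext}_A^{l}(X,M) \neq 0$ for some $l \geq 1$ and $\operatorname{Ext}_A^i(X,M)=0$ for all $i \geq l+1$ (for this $l$). Then the gendo-symmetric algebra $B:=\operatorname{End}_A(A \oplus X)$ is not weakly Gorenstein.
   Context: Algebras are finite dimensional, connected and non-semisimple over a field $K$; modules are finite dimensional right modules. $D=\operatorname{Hom}_K(-,K)$. An algebra $A$ is symmetric (symmetric Frobenius) if $A\cong D(A)$ as $A$-bimodules. An algebra is gendo-symmetric if it is isomorphic to $\operatorname{End}_A(N)$ for a symmetric algebra $A$ and a generator $N$ of $\operatorname{mod-}A$. A module $M$ is Gorenstein-projective if $\operatorname{Ext}^i(M,A)=0=\operatorname{Ext}^i(\operatorname{Tr}(M),A)$ for all $i\ge1$, where $\operatorname{Tr}$ is the Auslander-Bridger transpose; $M$ is Gorenstein-injective if $D(M)$ is Gorenstein-projective. An algebra $A$ is left weakly Gorenstein if every module $M$ with $\operatorname{Ext}_A^i(M,A)=0$ for all $i\ge1$ is Gorenstein-projective; it is right weakly Gorenstein if every module $M$ with $\operatorname{Ext}_A^i(D(A),M)=0$ for all $i\ge 1$ is Gorenstein-injective; it is weakly Gorenstein if it is both left and right weakly Gorenstein. *)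

(* Defs.v *)
From HB Require Import structures.
From mathcomp Require Import all_boot all_order all_algebra all_field.
Set Implicit Arguments.
Unset Strict Implicit.
Unset Printing Implicit Defensive.
Import GRing.Theory.
Local Open Scope ring_scope.

Section OppositeAlgebra.
Variables (K : fieldType) (A : falgType K).

HB.instance Definition _ := GRing.Lmodule.copy A^c A.
HB.instance Definition _ := Vector.copy A^c A.

HB.instance Definition _ := GRing.Lmodule_isLalgebra.Build K A^c
  (fun k (x y : A^c) => @scalerAr K A k y x).
HB.instance Definition _ := GRing.Lalgebra_isAlgebra.Build K A^c
  (fun k (x y : A^c) => @scalerAl K A k y x).

End OppositeAlgebra.

(* Finite-dimensional right modules. A left A-module is a right A^c-module. *)
Record rmodule (K : fieldType) (A : falgType K) := RModule {
  rmod_sort :> vectType K;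
  ract : rmod_sort -> A -> rmod_sort;
  ract_linearl : forall a, linear (ract^~ a);
  ract_linearr : forall x, linear (ract x);
  ract1 : forall x, ract x 1 = x;
  ractM : forall x a b, ract x (a * b) = ract (ract x a) b }.

Notation "x |* a" := (ract x a) (at level 40, left associativity) : ring_scope.

Section ModuleTheory.
Variables (K : fieldType) (A : falgType K).
Implicit Types L M N : rmodule A.

Section Action.
Variable M : rmodule A.

Definition act_by (a : A) (x : M) : M := x |* a.
HB.instance Definition _ (a : A) :=
  GRing.isLinear.Build K M M _ (act_by a) (ract_linearl a).

Definition ractl (a : A) : 'End(M) := linfun (act_by a).

Lemma ractlE a x : ractl a x = x |* a. Proof. exact: lfunE. Qed.

Lemma ractDl x y (a : A) : (x + y : M) |* a = x |* a + y |* a.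
Proof. by rewrite -!ractlE linearD. Qed.
Lemma ractZl k x (a : A) : (k *: x : M) |* a = k *: (x |* a).
Proof. by rewrite -!ractlE linearZ. Qed.
Lemma ractDr (x : M) a b : x |* (a + b) = x |* a + x |* b.
Proof. by have := ract_linearr x 1 a b; rewrite !scale1r. Qed.
Lemma ract0r (x : M) : x |* 0 = 0.
Proof. by apply: (addrI (x |* 0)); rewrite -ractDr !addr0. Qed.
Lemma ractZr (x : M) k a : x |* (k *: a) = k *: (x |* a).
Proof. by have := ract_linearr x k a 0; rewrite ract0r !addr0. Qed.

Definition submod (U : {vspace M}) : Prop :=
  forall x a, x \in U -> x |* a \in U.

End Action.

Section Homs.
Variables M N : rmodule A.

Definition hom_defect (a : A) (f : 'Hom(M, N)) : 'Hom(M, N) :=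
  (f \o ractl M a)%VF - (ractl N a \o f)%VF.
Fact hom_defect_linear a : linear (hom_defect a).
Proof.
move=> k f g; rewrite /hom_defect comp_lfunDl comp_lfunDr -comp_lfunZl.
by rewrite -comp_lfunZr scalerBr opprD addrACA.
Qed.
HB.instance Definition _ a := GRing.isLinear.Build K _ _ _ (hom_defect a)
  (hom_defect_linear a).

Definition HomA : {vspace 'Hom(M, N)} :=
  (\bigcap_(i < \dim {:A}) lker (linfun (hom_defect (vbasis {:A})`_i)))%VS.

Lemma HomAP (f : 'Hom(M, N)) :
  reflect (forall x a, f (x |* a) = f x |* a) (f \in HomA).
Proof.
rewrite memvE; apply: (iffP subv_bigcapP) => [fP x a | fP i _]; last first.
  rewrite -memvE memv_ker lfunE /= subr_eq0; apply/eqP/lfunP => x.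
  by rewrite !comp_lfunE !ractlE.
rewrite (coord_vbasis (memvf a)).
pose p (b : A) := f (x |* b) = f x |* b; rewrite -/(p _).
elim/big_rec: _ => [|i b _ pb]; rewrite /p ?ract0r ?linear0 //.
rewrite !ractDr !ractZr linearD linearZ /= pb; congr (_ *: _ + _).
have := fP i isT; rewrite -memvE memv_ker lfunE /= subr_eq0.
by move=> /eqP/lfunP/(_ x); rewrite !comp_lfunE !ractlE.
Qed.

End Homs.

Lemma HomA_id M : \1%VF \in HomA M M.
Proof. by apply/HomAP => x a; rewrite !id_lfunE. Qed.

Lemma HomA_comp L M N (f : 'Hom(M, N)) (g : 'Hom(L, M)) :
  f \in HomA M N -> g \in HomA L M -> (f \o g)%VF \in HomA L N.
Proof.
by move=> /HomAP fP /HomAP gP; apply/HomAP => x a; rewrite !comp_lfunE gP fP.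
Qed.

Lemma lker_submod M N (f : 'Hom(M, N)) : f \in HomA M N -> submod (lker f).
Proof.
move=> /HomAP fP x a; rewrite !memv_ker fP => /eqP ->.
by rewrite -ractlE linear0.
Qed.

Lemma limg_submod M N (f : 'Hom(M, N)) : f \in HomA M N -> submod (limg f).
Proof.
move=> /HomAP fP _ a /memv_imgP[x _ ->].
by rewrite -fP memv_img ?memvf.
Qed.

Definition mod_iso M N : Prop :=
  exists f : 'Hom(M, N), [/\ f \in HomA M N, lker f = 0%VS & limg f = fullv].

Section SubModule.
Variables (M : rmodule A) (U : {vspace M}) (sU : submod U).

Definition sub_act (x : subvs_of U) (a : A) : subvs_of U :=
  vsproj U (vsval x |* a).
Lemma sub_actE x a : vsval (sub_act x a) = vsval x |* a.
Proof. by rewrite vsprojK // sU // subvsP. Qed.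
Fact sub_act_linearl a : linear (sub_act^~ a).
Proof.
move=> k x y; apply: val_inj.
by rewrite /= !sub_actE /= ractDl ractZl.
Qed.
Fact sub_act_linearr x : linear (sub_act x).
Proof.
move=> k a b; apply: val_inj.
by rewrite /= !sub_actE ractDr ractZr.
Qed.
Fact sub_act1 x : sub_act x 1 = x.
Proof. by apply: val_inj; rewrite /= sub_actE ract1. Qed.
Fact sub_actM x a b : sub_act x (a * b) = sub_act (sub_act x a) b.
Proof. by apply: val_inj; rewrite /= !sub_actE ractM. Qed.

Definition sub_rmod :=
  RModule sub_act_linearl sub_act_linearr sub_act1 sub_actM.

End SubModule.

(* The quotient M / U lives on a linear complement of U; quot_proj is the     *)
(* canonical map M -> M / U, that is, the projection along U.                 *)
Section QuotientModule.
Variables (M : rmodule A) (U : {vspace M}) (sU : submod U).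

Definition quot_proj : 'Hom(M, subvs_of U^C) :=
  linfun (vsproj U^C \o daddv_pi U^C U).

Lemma val_quot_proj x : vsval (quot_proj x) = daddv_pi U^C U x.
Proof. by rewrite lfunE /= vsprojK ?memv_pi. Qed.

Fact compl_cap0 : (U^C :&: U = 0)%VS. Proof. by rewrite capvC capv_compl. Qed.

Lemma quot_projK x : quot_proj (vsval x) = x.
Proof. by apply: val_inj; rewrite /= val_quot_proj daddv_pi_id ?subvsP ?compl_cap0. Qed.

Lemma quot_proj_eq0 x : (quot_proj x == 0) = (x \in U).
Proof.
rewrite -(inj_eq val_inj) /= val_quot_proj.
have xE : daddv_pi U^C U x + daddv_pi U U^C x = x.
  by rewrite daddv_pi_add ?compl_cap0 // addvC addv_complf memvf.
apply/eqP/idP => [x0 | xU]; first by rewrite -xE x0 add0r memv_pi.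
apply: (addIr (daddv_pi U U^C x)); rewrite xE add0r.
by rewrite daddv_pi_id // capv_compl.
Qed.

Definition quot_act (x : subvs_of U^C) (a : A) : subvs_of U^C :=
  quot_proj (vsval x |* a).

Lemma quot_actE x a : quot_act (quot_proj x) a = quot_proj (x |* a).
Proof.
apply/eqP; rewrite -subr_eq0 -linearB /= quot_proj_eq0.
rewrite -!ractlE -linearB /= ractlE; apply: sU.
by rewrite -quot_proj_eq0 linearB /= quot_projK subrr.
Qed.

Fact quot_act_linearl a : linear (quot_act^~ a).
Proof. by move=> k x y; rewrite /quot_act !linearP /= ractDl ractZl linearP. Qed.
Fact quot_act_linearr x : linear (quot_act x).
Proof. by move=> k a b; rewrite /quot_act ractDr ractZr linearP. Qed.
Fact quot_act1 x : quot_act x 1 = x.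
Proof. by rewrite /quot_act ract1 quot_projK. Qed.
Fact quot_actM x a b : quot_act x (a * b) = quot_act (quot_act x a) b.
Proof. by rewrite {3}/quot_act quot_actE -ractM. Qed.

Definition quot_rmod :=
  RModule quot_act_linearl quot_act_linearr quot_act1 quot_actM.

End QuotientModule.

Section ZeroModule.
Let zact (x : 'rV[K]_0) (a : A) : 'rV[K]_0 := x.
Fact zact_linearl a : linear (zact^~ a). Proof. by []. Qed.
Fact zact_linearr x : linear (zact x).
Proof. by move=> k a b; rewrite /zact; apply/rowP => -[]. Qed.
Fact zact1 x : zact x 1 = x. Proof. by []. Qed.
Fact zactM x a b : zact x (a * b) = zact (zact x a) b. Proof. by []. Qed.
Definition zero_rmod := RModule zact_linearl zact_linearr zact1 zactM.
End ZeroModule.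

Section DirectSum.
Variables M N : rmodule A.
Let dact (x : (M * N)%type) (a : A) : (M * N)%type := (x.1 |* a, x.2 |* a).
Fact dact_linearl a : linear (dact^~ a).
Proof. by move=> k x y; rewrite /dact /= !ractDl !ractZl. Qed.
Fact dact_linearr x : linear (dact x).
Proof. by move=> k a b; rewrite /dact /= !ractDr !ractZr. Qed.
Fact dact1 x : dact x 1 = x.
Proof. by rewrite /dact !ract1; case: x. Qed.
Fact dactM x a b : dact x (a * b) = dact (dact x a) b.
Proof. by rewrite /dact !ractM. Qed.
Definition dsum := RModule dact_linearl dact_linearr dact1 dactM.
End DirectSum.

Section FreeModule.
Variable n : nat.
Let fact (u : {ffun 'I_n -> A}) (a : A) : {ffun 'I_n -> A} := [ffun i => u i * a].
Fact fact_linearl a : linear (fact^~ a).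
Proof.
by move=> k x y; apply/ffunP => i; rewrite !ffunE mulrDl -scalerAl.
Qed.
Fact fact_linearr x : linear (fact x).
Proof. by move=> k a b; apply/ffunP => i; rewrite !ffunE mulrDr -scalerAr. Qed.
Fact fact1 x : fact x 1 = x.
Proof. by apply/ffunP => i; rewrite ffunE mulr1. Qed.
Fact factM x a b : fact x (a * b) = fact (fact x a) b.
Proof. by apply/ffunP => i; rewrite !ffunE mulrA. Qed.
Definition free_rmod := RModule fact_linearl fact_linearr fact1 factM.
End FreeModule.

Section RegularModules.
Let ract0 (x a : A) : A := x * a.
Fact ract0_linearl a : linear (ract0^~ a).
Proof. by move=> k x y; rewrite /ract0 mulrDl -scalerAl. Qed.
Fact ract0_linearr x : linear (ract0 x).
Proof. by move=> k a b; rewrite /ract0 mulrDr -scalerAr. Qed.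
Fact ract01 x : ract0 x 1 = x. Proof. exact: mulr1. Qed.
Fact ract0M x a b : ract0 x (a * b) = ract0 (ract0 x a) b.
Proof. exact: mulrA. Qed.
Definition reg_rmod := RModule ract0_linearl ract0_linearr ract01 ract0M.

(* D(A) as a right A-module: (f a)(x) = f (a x). *)
Let dract (f : 'Hom(A, K^o)) (a : A) : 'Hom(A, K^o) := (f \o amull a)%VF.
Fact dract_linearl a : linear (dract^~ a).
Proof. by move=> k f g; rewrite /dract comp_lfunDl comp_lfunZl. Qed.
Fact dract_linearr f : linear (dract f).
Proof. by move=> k a b; rewrite /dract linearP comp_lfunDr comp_lfunZr. Qed.
Fact dract1 f : dract f 1 = f.
Proof. by rewrite /dract amull1 comp_lfun1r. Qed.
Fact dractM f a b : dract f (a * b) = dract (dract f a) b.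
Proof.
by apply/lfunP => x; rewrite !comp_lfunE !lfunE /= mulrA.
Qed.
Definition dual_reg_rmod := RModule dract_linearl dract_linearr dract1 dractM.
End RegularModules.

(* D(M), with (f a)(x) = f (x a). *)
Section DualModule.
Variable M : rmodule A.
Let mact (f : 'Hom(M, K^o)) (a : A^c) : 'Hom(M, K^o) := (f \o ractl M a)%VF.
Fact mact_linearl a : linear (mact^~ a).
Proof. by move=> k f g; rewrite /mact comp_lfunDl comp_lfunZl. Qed.
Fact mact_linearr f : linear (mact f).
Proof.
move=> k a b; apply/lfunP => x; rewrite add_lfunE scale_lfunE.
by rewrite !comp_lfunE !ractlE ractDr ractZr linearP.
Qed.
Fact mact1 f : mact f 1 = f.
Proof. by apply/lfunP => x; rewrite comp_lfunE ractlE ract1. Qed.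
Fact mactM f a b : mact f (a * b) = mact (mact f a) b.
Proof. by apply/lfunP => x; rewrite !comp_lfunE !ractlE ractM. Qed.
Definition dual_rmod : rmodule A^c :=
  RModule mact_linearl mact_linearr mact1 mactM.
End DualModule.

(* Hom_A(M, A), with (f a)(x) = a (f x). *)
Section StarModule.
Variable M : rmodule A.

Fact star_mem (f : 'Hom(M, reg_rmod)) (a : A) :
  f \in HomA M reg_rmod -> (amull a \o f)%VF \in HomA M reg_rmod.
Proof.
move=> /HomAP fP; apply/HomAP => x b; rewrite !comp_lfunE !lfunE /= fP.
exact: mulrA.
Qed.

Let sact (f : subvs_of (HomA M reg_rmod)) (a : A^c) : subvs_of (HomA M reg_rmod)
  := vsproj _ (amull (a : A) \o vsval f)%VF.

Lemma star_actE f a x : vsval (sact f a) x = (a : A) * vsval f x.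
Proof. by rewrite vsprojK ?star_mem ?subvsP // comp_lfunE lfunE. Qed.

Fact sact_linearl a : linear (sact^~ a).
Proof.
move=> k f g; apply/val_inj/lfunP => x.
rewrite /= star_actE /= !add_lfunE !scale_lfunE !star_actE.
by rewrite mulrDr -scalerAr.
Qed.
Fact sact_linearr f : linear (sact f).
Proof.
move=> k a b; apply/val_inj/lfunP => x.
by rewrite /= star_actE /= !add_lfunE !scale_lfunE !star_actE mulrDl -scalerAl.
Qed.
Fact sact1 f : sact f 1 = f.
Proof. by apply/val_inj/lfunP => x; rewrite /= star_actE mul1r. Qed.
Fact sactM f a b : sact f (a * b) = sact (sact f a) b.
Proof. by apply/val_inj/lfunP => x; rewrite /= !star_actE -mulrA. Qed.
Definition star_rmod : rmodule A^c :=
  RModule sact_linearl sact_linearr sact1 sactM.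
End StarModule.

Section Cover.
Variable M : rmodule A.

Definition cover_fun (u : free_rmod (\dim {:M})) : M :=
  \sum_(i < \dim {:M}) (vbasis {:M})`_i |* (u : {ffun _ -> A}) i.
Fact cover_fun_linear : linear cover_fun.
Proof.
move=> k u v; rewrite /cover_fun scaler_sumr -big_split.
by apply: eq_bigr => i _; rewrite !ffunE ractDr ractZr.
Qed.
HB.instance Definition _ := GRing.isLinear.Build K _ _ _ cover_fun
  cover_fun_linear.

Definition cover : 'Hom(free_rmod (\dim {:M}), M) := linfun cover_fun.

Lemma cover_hom : cover \in HomA _ M.
Proof.
apply/HomAP => u a; rewrite !lfunE /= /cover_fun.
rewrite -[RHS]ractlE linear_sum; apply: eq_bigr => i _.
by rewrite ffunE ractM -ractlE.
Qed.

Lemma cover_onto : limg cover = fullv.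
Proof.
apply/vspaceP => x; rewrite memvf; apply/memv_imgP.
exists ([ffun i => (coord (vbasis {:M}) i x)%:A] : free_rmod (\dim {:M})).
  exact: memvf.
rewrite lfunE /= /cover_fun {1}(coord_vbasis (memvf x)).
by apply: eq_bigr => i _; rewrite ffunE ractZr ract1.
Qed.

Definition syzygy : rmodule A := sub_rmod (lker_submod cover_hom).

End Cover.

(* The standard free resolution                                               *)
(*   ... -> res M 2 -> res M 1 -> res M 0 -> M -> 0,                          *)
(* with differentials res_d M i : res M i.+1 -> res M i and augmentation      *)
(* cover M.                                                                   *)
Definition res M i : rmodule A := free_rmod (\dim {:iter i syzygy M}).
Definition res_d M i : 'Hom(res M i.+1, res M i) :=
  (linfun vsval \o cover (iter i.+1 syzygy M))%VF.

Lemma res_d_hom M i : res_d M i \in HomA (res M i.+1) (res M i).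
Proof.
have /HomAP cP := cover_hom (iter i.+1 syzygy M).
apply/HomAP => x a; rewrite !comp_lfunE cP !(lfunE vsval).
exact: (sub_actE (lker_submod (cover_hom _))).
Qed.

Lemma limg_res_d M i : limg (res_d M i) = lker (cover (iter i syzygy M)).
Proof.
rewrite limg_comp cover_onto; apply/vspaceP => x; apply/memv_imgP/idP.
  by case=> y _ ->; rewrite (lfunE vsval) subvsP.
by move=> xK; exists (Subvs xK); rewrite ?memvf // (lfunE vsval).
Qed.

Lemma res_exact0 M : limg (res_d M 0) = lker (cover M).
Proof. exact: limg_res_d. Qed.

Lemma res_exact M i : limg (res_d M i.+1) = lker (res_d M i).
Proof.
rewrite limg_res_d; apply/vspaceP => x; rewrite !memv_ker comp_lfunE.
by rewrite (lfunE vsval) -(inj_eq val_inj).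
Qed.

Definition projective_mod (P : rmodule A) : Prop :=
  forall (Y Z : rmodule A) (g : 'Hom(Y, Z)) (f : 'Hom(P, Z)),
    g \in HomA Y Z -> limg g = fullv -> f \in HomA P Z ->
    exists2 h : 'Hom(P, Y), h \in HomA P Y & (g \o h)%VF = f.

Lemma free_projective n : projective_mod (free_rmod n).
Proof.
move=> Y Z g f /HomAP gH g_onto /HomAP fH.
pose e (i : 'I_n) : free_rmod n := [ffun j => (j == i)%:R].
pose hf (u : free_rmod n) : Y :=
  \sum_(i < n) g^-1%VF (f (e i)) |* (u : {ffun _ -> A}) i.
have hf_linear : linear hf.
  move=> k u v; rewrite /hf scaler_sumr -big_split.
  by apply: eq_bigr => i _; rewrite !ffunE ractDr ractZr.
pose hL := GRing.isLinear.Build K _ _ _ hf hf_linear.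
pose hl : {linear free_rmod n -> Y} := HB.pack hf hL.
have hE u : linfun hl u = hf u by rewrite lfunE.
exists (linfun hl).
  apply/HomAP => u a; rewrite !hE /hf -[RHS]ractlE linear_sum.
  by apply: eq_bigr => i _; rewrite ffunE ractM -ractlE.
apply/lfunP => u; rewrite comp_lfunE hE linear_sum.
have uE : u = \sum_(i < n) e i |* (u : {ffun _ -> A}) i.
  apply/ffunP => j; rewrite sum_ffunE (bigD1 j) //= !ffunE eqxx mul1r.
  by rewrite big1 ?addr0 // => i /negPf ij; rewrite !ffunE eq_sym ij mul0r.
rewrite [in RHS]uE linear_sum; apply: eq_bigr => i _.
by rewrite /= gH limg_lfunVK ?g_onto ?memvf // -fH.
Qed.

Section Precomposition.
Variables (P Q N : rmodule A) (d : 'Hom(P, Q)).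
Definition precomp (f : 'Hom(Q, N)) : 'Hom(P, N) := (f \o d)%VF.
Fact precomp_linear : linear precomp.
Proof. by move=> k f g; rewrite /precomp comp_lfunDl comp_lfunZl. Qed.
HB.instance Definition _ := GRing.isLinear.Build K _ _ _ precomp precomp_linear.
Lemma precompE f : linfun precomp f = (f \o d)%VF. Proof. exact: lfunE. Qed.
End Precomposition.

Definition cocycles i M N : {vspace 'Hom(res M i, N)} :=
  (HomA (res M i) N :&: lker (linfun (precomp (N := N) (res_d M i))))%VS.
Definition coboundaries i M N : {vspace 'Hom(res M i, N)} :=
  match i with
  | 0 => 0%VS
  | j.+1 => (linfun (precomp (N := N) (res_d M j)) @: HomA (res M j) N)%VS
  end.

(* The quotient of cocycles by coboundaries, realised as a linear complement. *)
Definition Ext i M N : {vspace 'Hom(res M i, N)} :=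
  (cocycles i M N :\: coboundaries i M N)%VS.

Lemma coboundaries_sub i M N : (coboundaries i M N <= cocycles i M N)%VS.
Proof.
case: i => [|i]; first exact: sub0v.
apply/subvP => _ /memv_imgP[f fH ->]; rewrite memv_cap memv_ker !precompE.
apply/andP; split; first exact: HomA_comp fH (res_d_hom M i).
apply/eqP/lfunP => x; rewrite -comp_lfunA comp_lfunE zero_lfunE.
suff -> : (res_d M i \o res_d M i.+1)%VF x = 0 by rewrite linear0.
by apply/eqP; rewrite comp_lfunE -memv_ker -res_exact memv_img ?memvf.
Qed.

Lemma Ext_eq0 i M N :
  (Ext i M N == 0%VS) = (cocycles i M N == coboundaries i M N).
Proof. by rewrite diffv_eq0 eqEsubv coboundaries_sub andbT. Qed.

(* Tr(M) is the cokernel of Hom_A(P_0, A) -> Hom_A(P_1, A) for the            *)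
(* presentation P_1 -> P_0 -> M -> 0 given by the standard free resolution.   *)
(* Other projective presentations change it by projective summands only.      *)
Section Transpose.
Variable M : rmodule A.

Definition star_d_fun (f : star_rmod (res M 0)) : star_rmod (res M 1) :=
  vsproj _ (vsval f \o res_d M 0)%VF.
Lemma star_d_funE f x : vsval (star_d_fun f) x = vsval f (res_d M 0 x).
Proof. by rewrite vsprojK ?comp_lfunE // HomA_comp ?subvsP ?res_d_hom. Qed.
Fact star_d_linear : linear star_d_fun.
Proof.
move=> k f g; apply/val_inj/lfunP => x.
by rewrite /= star_d_funE /= !add_lfunE !scale_lfunE !star_d_funE.
Qed.
HB.instance Definition _ := GRing.isLinear.Build K _ _ _ star_d_fun
  star_d_linear.

Definition star_d : 'Hom(star_rmod (res M 0), star_rmod (res M 1)) :=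
  linfun star_d_fun.

End Transpose.

Definition summands_cond M (U V : {vspace M}) : Prop :=
  [/\ submod U, submod V, (U + V = fullv)%VS & (U :&: V = 0)%VS].

Definition indecomposable M : Prop :=
  ({:M} != 0)%VS /\
  forall U V : {vspace M}, summands_cond U V -> U = 0%VS \/ V = 0%VS.

Definition semisimple_mod M : Prop :=
  forall U : {vspace M}, submod U -> exists V : {vspace M}, summands_cond U V.

End ModuleTheory.

Lemma star_d_hom (K : fieldType) (A : falgType K) (M : rmodule A) :
  star_d M \in HomA (star_rmod (res M 0)) (star_rmod (res M 1)).
Proof.
apply/HomAP => f a; rewrite !lfunE; apply: subvs_inj; apply/lfunP => x.
by rewrite star_d_funE !star_actE star_d_funE.
Qed.

Definition transpose (K : fieldType) (A : falgType K) (M : rmodule A) :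
    rmodule A^c :=
  quot_rmod (limg_submod (star_d_hom M)).

(* End_A(N), multiplied by composition: (f * g) x = f (g x). The hypothesis   *)
(* N != 0 is there because an falgType satisfies 1 != 0.                      *)
Section EndomorphismAlgebra.
Variables (K : fieldType) (A : falgType K) (N : rmodule A).

Definition endo (N_neq0 : ({:N} != 0)%VS) : Type := subvs_of (HomA N N).

Variable N_neq0 : ({:N} != 0)%VS.
Local Notation E := (endo N_neq0).
HB.instance Definition _ := Vector.copy E (subvs_of (HomA N N)).

Definition endo_one : E := Subvs (HomA_id N).
Definition endo_mul (f g : E) : E := Subvs (HomA_comp (subvsP f) (subvsP g)).

Fact endo_mulA : associative endo_mul.
Proof. by move=> f g h; apply/val_inj/comp_lfunA. Qed.
Fact endo_mul1 : left_id endo_one endo_mul.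
Proof. by move=> f; apply/val_inj/comp_lfun1l. Qed.
Fact endo_1mul : right_id endo_one endo_mul.
Proof. by move=> f; apply/val_inj/comp_lfun1r. Qed.
Fact endo_mulDl : left_distributive endo_mul +%R.
Proof. by move=> f g h; apply/val_inj/comp_lfunDl. Qed.
Fact endo_mulDr : right_distributive endo_mul +%R.
Proof. by move=> f g h; apply/val_inj/comp_lfunDr. Qed.
Fact endo_one_neq0 : endo_one != 0.
Proof.
apply: contraNneq N_neq0 => /(congr1 vsval)/lfunP N0.
rewrite -subv0; apply/subvP => x _.
by have /= := N0 x; rewrite id_lfunE zero_lfunE => ->; rewrite mem0v.
Qed.

HB.instance Definition _ := GRing.Zmodule_isNzRing.Build E
  endo_mulA endo_mul1 endo_1mul endo_mulDl endo_mulDr endo_one_neq0.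

Fact endo_scalerAl (k : K) (f g : E) : k *: (f * g) = (k *: f) * g.
Proof. by apply/val_inj/comp_lfunZl. Qed.
HB.instance Definition _ := GRing.Lmodule_isLalgebra.Build K E endo_scalerAl.
Fact endo_scalerAr (k : K) (f g : E) : k *: (f * g) = f * (k *: g).
Proof. by apply/val_inj/comp_lfunZr. Qed.
HB.instance Definition _ := GRing.Lalgebra_isAlgebra.Build K E endo_scalerAr.
HB.instance Definition _ := Algebra_isFalgebra.Build K E.

Definition endo_algebra : falgType K := E.

End EndomorphismAlgebra.

Lemma dsum_reg_neq0 (K : fieldType) (A : falgType K) (X : rmodule A) :
  ({:dsum (reg_rmod A) X} != 0)%VS.
Proof.
apply/eqP => AX0; have := memvf ((1, 0) : dsum (reg_rmod A) X).
rewrite AX0 memv0 => /eqP[]; apply/eqP; exact: oner_neq0.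
Qed.

Section Properties.
Variables (K : fieldType) (A : falgType K).

Definition connected_algebra : Prop :=
  forall e : A, e * e = e -> (forall a, e * a = a * e) -> e = 0 \/ e = 1.

Definition semisimple_algebra : Prop := semisimple_mod (reg_rmod A).

(* D(A) has the bimodule structure (a f b)(y) = f (b y a). *)
Definition symmetric_algebra : Prop :=
  exists phi : 'Hom(A, 'Hom(A, K^o)),
    [/\ lker phi = 0%VS, limg phi = fullv &
        forall a x b y, phi (a * x * b) y = phi x (b * y * a)].

Definition direct_sum (m : nat) (Xs : 'I_m -> rmodule A) : rmodule A :=
  \big[@dsum K A / zero_rmod A]_(i < m) Xs i.

End Properties.

Section Gorenstein.
Variable K : fieldType.

Definition gorenstein_projective (A : falgType K) (M : rmodule A) : Prop :=
  (forall i, (1 <= i)%N -> Ext i M (reg_rmod A) = 0%VS) /\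
  (forall i, (1 <= i)%N -> Ext i (transpose M) (reg_rmod A^c) = 0%VS).

Definition gorenstein_injective (A : falgType K) (M : rmodule A) : Prop :=
  gorenstein_projective (dual_rmod M).

Definition left_weakly_gorenstein (A : falgType K) : Prop :=
  forall M : rmodule A,
    (forall i, (1 <= i)%N -> Ext i M (reg_rmod A) = 0%VS) ->
    gorenstein_projective M.

Definition right_weakly_gorenstein (A : falgType K) : Prop :=
  forall M : rmodule A,
    (forall i, (1 <= i)%N -> Ext i (dual_reg_rmod A) M = 0%VS) ->
    gorenstein_injective M.

Definition weakly_gorenstein (A : falgType K) : Prop :=
  left_weakly_gorenstein A /\ right_weakly_gorenstein A.

End Gorenstein.

(* Main.v *)
From HB Require Import structures.
From mathcomp Require Import all_boot all_order all_algebra all_field.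
Require Import Defs.
Set Implicit Arguments.
Unset Strict Implicit.
Unset Printing Implicit Defensive.
Import GRing.Theory.
Local Open Scope ring_scope.

(** The algebra [B] fails to be right weakly Gorenstein, and the witness is
explicit. Write N = A + X and consider the functor Hom_A(N, -) from right
A-modules to right B-modules. Every A-module L embeds in the coinduced module
I(L) = Hom_K(A, L), which is injective; call the cokernel C(L). Dimension
shifting along 0 -> L -> I(L) -> C(L) -> 0 gives
Ext^i(X, C(L)) = Ext^(i+1)(X, L) for i >= 1, while Ext^1(X, L) measures which
maps from X to C(L) fail to lift to I(L). So, applying C to M exactly l - 1
times, one gets a module L such that Ext^i(X, C(L)) = 0 for all i >= 1 although
some map from N to C(L) does not lift to I(L). Put G = Hom_A(N, C(L)).

Ext^i_B(D(B), G) = 0 for i >= 1 ([ext1_dual_reg_hom]). Since Ext(N, -) vanishes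
on C(L) and on its further cosyzygies, Hom_A(N, -) keeps the coinduced
coresolution of C(L) exact, and it turns coinduced modules into injective
B-modules ([hom_coind_injective]). It remains to lift maps from D(B) through
Hom_A(N, I) -> Hom_A(N, C). Let e be the projection of N onto A. Maps from D(B)
to Hom_A(N, C) are the same as A-maps from D(B)e = D(eB) = D(Hom_A(N, A)) to C,
and D(Hom_A(N, A)) is isomorphic to N because A is symmetric; maps from N lift
by the choice of C ([lifts_dual_reg]).

G is not Gorenstein-injective ([lifts_of_gorenstein_injective]). If it were,
then Ext^1(Tr D(G), B) = 0 would make D(G) torsionless, by a theorem of
Auslander and Bridger ([torsionless_of_ext1_transpose]). The maps from N to
C(L) that lift to I(L) form a proper subspace of G, so some nonzero functional x
on G vanishes on it. A map from N to C(L) that factors through A lifts, hence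
(eB)x = 0. If b in B is the image of x under a homomorphism from D(G) to B, then
(eB)b = 0, that is, every homomorphism from N to A vanishes on b(N). But a
symmetric algebra cogenerates its modules, so b = 0. Hence all homomorphisms
from D(G) to B kill x, which contradicts torsionlessness. *)

(** * Short exact sequences, lifting and the vanishing of Ext *)

(** The linear map is chosen behind an opaque proof: a transparent packing
unfolds during rewriting, and then [lfun_ofE] matches unrelated linear maps. *)
Fact lfun_of_sig (K : fieldType) (U V : vectType K) (f : U -> V) :
  linear f -> {g : 'Hom(U, V) | g =1 f}.
Proof.
move=> f_lin; pose fL := GRing.isLinear.Build K U V _ f f_lin.
by exists (linfun (HB.pack f fL : {linear U -> V})) => x; exact: lfunE.
Qed.

Definition lfun_of (K : fieldType) (U V : vectType K) (f : U -> V)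
  (f_lin : linear f) : 'Hom(U, V) := sval (lfun_of_sig f_lin).

Lemma lfun_ofE (K : fieldType) (U V : vectType K) (f : U -> V)
  (f_lin : linear f) x : lfun_of f_lin x = f x.
Proof. exact: (svalP (lfun_of_sig f_lin)). Qed.

Lemma lker0_inj (K : fieldType) (U V : vectType K) (f : 'Hom(U, V)) :
  lker f = 0%VS -> injective f.
Proof. by move=> f0; apply/lker0P; rewrite f0. Qed.

Section Vanishing.
Variables (K : fieldType) (A : falgType K).
Implicit Types L M N P Q I C Y Z : rmodule A.

Lemma hom_factor P Q L (p : 'Hom(P, Q)) (f : 'Hom(P, L)) :
    p \in HomA P Q -> limg p = fullv -> f \in HomA P L ->
    (forall x, p x = 0 -> f x = 0) ->
  exists2 h : 'Hom(Q, L), h \in HomA Q L & forall x, h (p x) = f x.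
Proof.
move=> /HomAP pH p_onto /HomAP fH kpf.
have pK y : p (p^-1%VF y) = y by rewrite limg_lfunVK ?p_onto ?memvf.
have hE x : (f \o p^-1)%VF (p x) = f x.
  rewrite comp_lfunE; apply/eqP; rewrite -subr_eq0 -linearB.
  by apply/eqP/kpf; rewrite linearB /= pK subrr.
exists (f \o p^-1)%VF => //; apply/HomAP => y a.
by rewrite -{1}[y]pK -pH hE fH comp_lfunE.
Qed.

Definition short_exact L I C (i : 'Hom(L, I)) (p : 'Hom(I, C)) : Prop :=
  [/\ i \in HomA L I /\ p \in HomA I C, lker i = 0%VS, limg i = lker p
    & limg p = fullv].

Lemma short_exact_lift L I C (i : 'Hom(L, I)) (p : 'Hom(I, C)) Z
    (f : 'Hom(Z, I)) :
    short_exact i p -> f \in HomA Z I -> (forall z, p (f z) = 0) ->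
  exists2 g : 'Hom(Z, L), g \in HomA Z L & forall z, i (g z) = f z.
Proof.
move=> [[/HomAP iH pH] i0 ip p_onto] /HomAP fH pf.
have iK z : i (i^-1%VF (f z)) = f z.
  by rewrite limg_lfunVK // ip memv_ker pf.
exists (i^-1 \o f)%VF => [|z]; last by rewrite comp_lfunE.
apply/HomAP => z a; rewrite !comp_lfunE.
apply: (lker0_inj i0).
by rewrite iK iH iK fH.
Qed.

Definition lifts I C (p : 'Hom(I, C)) Z : Prop :=
  forall f : 'Hom(Z, C), f \in HomA Z C ->
  exists2 g : 'Hom(Z, I), g \in HomA Z I & forall z, p (g z) = f z.

Lemma free_lifts n I C (p : 'Hom(I, C)) :
  p \in HomA I C -> limg p = fullv -> lifts p (free_rmod A n).
Proof.
move=> pH p_onto f fH.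
have [g gH gE] := free_projective pH p_onto fH.
by exists g => // z; rewrite -gE comp_lfunE.
Qed.

Definition injective_mod I : Prop :=
  forall Y Z (j : 'Hom(Y, Z)) (f : 'Hom(Y, I)),
    j \in HomA Y Z -> lker j = 0%VS -> f \in HomA Y I ->
    exists2 g : 'Hom(Z, I), g \in HomA Z I & forall y, g (j y) = f y.

Definition ker_incl P Q (p : 'Hom(P, Q)) (pH : p \in HomA P Q) :
    'Hom(sub_rmod (lker_submod pH), P) :=
  linfun (vsval : sub_rmod (lker_submod pH) -> P).

Lemma ker_short_exact P Q (p : 'Hom(P, Q)) (pH : p \in HomA P Q) :
  limg p = fullv -> short_exact (ker_incl pH) p.
Proof.
have iE x : ker_incl pH x = vsval x by rewrite lfunE.
split=> //; first split=> //.
- apply/HomAP => x a; rewrite !iE; exact: (sub_actE (lker_submod pH)).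
- apply/eqP/lker0P => x y; rewrite !iE; exact: val_inj.
apply/vspaceP => x; apply/memv_imgP/idP => [[y _ ->]|xK].
  by rewrite iE subvsP.
by exists (Subvs xK); rewrite ?memvf // iE.
Qed.

Definition syz_incl Z : 'Hom(syzygy Z, free_rmod A (\dim {:Z})) :=
  ker_incl (cover_hom Z).

Lemma syz_short_exact Z : short_exact (syz_incl Z) (cover Z).
Proof. exact/ker_short_exact/cover_onto. Qed.

(** Ext^1(Z, L) = 0, in the form: restriction from the free cover to the syzygy
is surjective on maps into L. *)
Definition ext1_zero Z L : Prop :=
  forall f : 'Hom(syzygy Z, L), f \in HomA (syzygy Z) L ->
  exists2 g : 'Hom(free_rmod A (\dim {:Z}), L),
    g \in HomA _ L & forall z, g (syz_incl Z z) = f z.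

(** The higher Ext groups of Z are the first Ext groups of its syzygies: a cocycle
on the term i + 1 of the resolution is a map that factors through the syzygy
covered by that term. *)
Lemma Ext_ext1_zero i Z L :
  Ext i.+1 Z L = 0%VS <-> ext1_zero (iter i (@syzygy K A) Z) L.
Proof.
have dE x : res_d Z i x = syz_incl (iter i (@syzygy K A) Z)
    (cover (iter i.+1 (@syzygy K A) Z) x) by rewrite comp_lfunE.
split=> [/eqP|E1].
  rewrite Ext_eq0 => /eqP E f fH.
  have: (f \o cover (iter i.+1 (@syzygy K A) Z))%VF \in cocycles i.+1 Z L.
    rewrite memv_cap; apply/andP; split; first exact: HomA_comp fH (cover_hom _).
    rewrite memv_ker precompE; apply/eqP/lfunP => x.
    rewrite 2!comp_lfunE zero_lfunE.
    suff /eqP -> : cover (iter i.+1 (@syzygy K A) Z) (res_d Z i.+1 x) == 0.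
      exact: linear0.
    by rewrite -memv_ker -limg_res_d memv_img ?memvf.
  rewrite E => /memv_imgP[g gH /lfunP gE]; exists g => // z.
  have /memv_imgP[x _ ->]: z \in limg (cover (iter i.+1 (@syzygy K A) Z)).
    by rewrite cover_onto memvf.
  by have := gE x; rewrite precompE !comp_lfunE.
apply/eqP; rewrite Ext_eq0 eqEsubv coboundaries_sub andbT; apply/subvP => h.
rewrite memv_cap memv_ker precompE => /andP[hH /eqP/lfunP hd].
have [x|f fH fE] := hom_factor (cover_hom (iter i.+1 (@syzygy K A) Z))
    (cover_onto _) hH.
  move=> /eqP; rewrite -memv_ker -limg_res_d => /memv_imgP[y _ ->].
  by have := hd y; rewrite comp_lfunE zero_lfunE.
have [g gH gE] := E1 f fH.
apply/memv_imgP; exists g => //; apply/lfunP => x.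
by rewrite precompE comp_lfunE dE gE fE.
Qed.

Section Shift.
Variables (L I C : rmodule A) (i : 'Hom(L, I)) (p : 'Hom(I, C)).
Hypotheses (ip : short_exact i p) (I_inj : injective_mod I).

(** Apply Hom(Z, -) to 0 -> L -> I -> C -> 0: as Ext^1(Z, I) = 0, the cokernel
of Hom(Z, I) -> Hom(Z, C) is Ext^1(Z, L). *)
Lemma ext1_zero_lifts Z : ext1_zero Z L <-> lifts p Z.
Proof.
have [[iH pH] i0 ipE p_onto] := ip.
have pi x : p (i x) = 0.
  by apply/eqP; rewrite -memv_ker -ipE memv_img ?memvf.
have [[sH cH] s0 sE c_onto] := syz_short_exact Z.
have cs x : cover Z (syz_incl Z x) = 0.
  by apply/eqP; rewrite -memv_ker -sE memv_img ?memvf.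
split=> [E1 f fH|lp f fH].
  have [psi psiH psiE] := free_lifts pH p_onto (HomA_comp fH cH).
  have [z|r rH rE] := short_exact_lift ip (HomA_comp psiH sH).
    by rewrite comp_lfunE psiE comp_lfunE cs linear0.
  have [g gH gE] := E1 r rH.
  have dH : psi - (i \o g)%VF \in HomA _ I by rewrite memvB ?HomA_comp.
  have [z|h hH hE] := hom_factor cH c_onto dH.
    move=> /eqP; rewrite -memv_ker -sE => /memv_imgP[y _ ->].
    by rewrite add_lfunE opp_lfunE comp_lfunE gE rE comp_lfunE subrr.
  exists h => // z.
  have /memv_imgP[y _ ->]: z \in limg (cover Z) by rewrite c_onto memvf.
  by rewrite hE add_lfunE opp_lfunE linearB /= psiE !comp_lfunE pi subr0.
have [psi psiH psiE] := I_inj sH s0 (HomA_comp iH fH).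
have [z|q qH qE] := hom_factor cH c_onto (HomA_comp pH psiH).
  move=> /eqP; rewrite -memv_ker -sE => /memv_imgP[y _ ->].
  by rewrite comp_lfunE psiE comp_lfunE pi.
have [r rH rE] := lp q qH.
have dH : psi - (r \o cover Z)%VF \in HomA _ I by rewrite memvB ?HomA_comp.
have [z|g gH gE] := short_exact_lift ip dH.
  by rewrite add_lfunE opp_lfunE linearB /= comp_lfunE rE qE comp_lfunE subrr.
exists g => // z; apply: (lker0_inj i0).
by rewrite gE add_lfunE opp_lfunE psiE !comp_lfunE cs linear0 subr0.
Qed.

(** Both sides say that maps from the syzygy of Z to C lift through p: the right
one by [ext1_zero_lifts], the left one because such a map extends to the free
cover exactly if it lifts, the cover being projective and I injective. *)
Lemma ext1_zero_shift Z : ext1_zero Z C <-> ext1_zero (syzygy Z) L.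
Proof.
have [[iH pH] i0 ipE p_onto] := ip.
have [[sH cH] s0 sE c_onto] := syz_short_exact Z.
apply: (iff_trans _ (iff_sym (ext1_zero_lifts _))); split=> [E1|lp] f fH.
  have [g gH gE] := E1 f fH.
  have [h hH hE] := free_lifts pH p_onto gH.
  by exists (h \o syz_incl Z)%VF; rewrite ?HomA_comp // => z; rewrite comp_lfunE hE.
have [g gH gE] := lp f fH.
have [h hH hE] := I_inj sH s0 gH.
by exists (p \o h)%VF; rewrite ?HomA_comp // => z; rewrite comp_lfunE hE.
Qed.

End Shift.

(** The vanishing of Ext^1(Y, L) does not depend on the presentation of Y: a map
on U pulls back to the syzygy, the pullback extends to the free cover of Y, and
the two glue because P is the pushout of U and that cover over the syzygy. *)
Lemma ext1_zero_extend P Y L (p : 'Hom(P, Y)) :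
    p \in HomA P Y -> limg p = fullv -> ext1_zero Y L ->
  forall (U : rmodule A) (j : 'Hom(U, P)) (f : 'Hom(U, L)),
    short_exact j p -> f \in HomA U L ->
  exists2 g : 'Hom(P, L), g \in HomA P L & forall u, g (j u) = f u.
Proof.
move=> pH p_onto E1 U j f jp fH.
have [[jH _] j0 jpE _] := jp.
have pj x : p (j x) = 0 by apply/eqP; rewrite -memv_ker -jpE memv_img ?memvf.
have [[sH cH] s0 sE c_onto] := syz_short_exact Y.
have [al alH alE] := free_lifts pH p_onto cH.
have [z|be beH beE] := short_exact_lift jp (HomA_comp alH sH).
  rewrite comp_lfunE alE; apply/eqP; rewrite -memv_ker -sE.
  by rewrite memv_img ?memvf.
have [g gH gE] := E1 _ (HomA_comp fH beH).
(* P is the quotient of S by a copy of the syzygy of Y. *)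
pose S := dsum U (free_rmod A (\dim {:Y})).
have lin (V : rmodule A) (h : 'Hom(U, V)) (k : 'Hom(free_rmod A (\dim {:Y}), V)) :
    linear (fun w : S => h w.1 + k w.2).
  by move=> c u v; rewrite /= !linearP /= scalerDr addrACA.
have linH (V : rmodule A) (h : 'Hom(U, V)) (k : 'Hom(free_rmod A (\dim {:Y}), V)) :
    h \in HomA U V -> k \in HomA _ V -> lfun_of (lin V h k) \in HomA S V.
  move=> /HomAP hH /HomAP kH; apply/HomAP => w a.
  by rewrite !lfun_ofE /= ractDl -hH -kH.
have s_onto : limg (lfun_of (lin P j al)) = fullv.
  apply/vspaceP => x; rewrite memvf.
  have /memv_imgP[y _ yE]: p x \in limg (cover Y) by rewrite c_onto memvf.
  have /memv_imgP[u _ uE]: x - al y \in limg j.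
    by rewrite jpE memv_ker linearB /= alE yE subrr.
  apply/memv_imgP; exists ((u, y) : S); rewrite ?memvf // lfun_ofE /=.
  by rewrite -uE subrK.
have [w|h hH hE] := hom_factor (linH _ _ _ jH alH) s_onto (linH _ _ _ fH gH).
  rewrite !lfun_ofE => w0.
  have /memv_imgP[z _ zE]: w.2 \in limg (syz_incl Y).
    by rewrite sE memv_ker -alE -[al _](addKr (j w.1)) w0 addr0 linearN /= pj oppr0.
  have jw : j (w.1 + be z) = 0 by rewrite linearD /= beE comp_lfunE -zE.
  rewrite zE gE comp_lfunE -linearD.
  have -> : w.1 + be z = 0 by apply/eqP; rewrite -memv0 -j0 memv_ker jw.
  exact: linear0.
exists h => // u; have := hE ((u, 0) : S); rewrite !lfun_ofE /=.
by rewrite !linear0 !addr0.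
Qed.

End Vanishing.

(** * Quotients and torsionless modules *)

Section Quotient.
Variables (K : fieldType) (A : falgType K) (P : rmodule A).
Variables (U : {vspace P}) (sU : submod U).

Lemma quot_proj_hom : quot_proj U \in HomA P (quot_rmod sU).
Proof. by apply/HomAP => x a; rewrite /= quot_actE. Qed.

Lemma lker_quot_proj : lker (quot_proj U) = U.
Proof. by apply/vspaceP => x; rewrite memv_ker quot_proj_eq0. Qed.

Lemma limg_quot_proj : limg (quot_proj U) = fullv.
Proof.
apply/vspaceP => x; rewrite memvf -[x](quot_projK (U := U)).
by rewrite memv_img ?memvf.
Qed.

End Quotient.

Section Torsionless.
Variables (K : fieldType) (A : falgType K).

Lemma star_ractE (M : rmodule A) (f : star_rmod M) (a : A^c) (x : M) :
  vsval (f |* a) x = (a : A) * vsval f x.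
Proof. by have := star_actE f a x. Qed.

Fact star_eval_linear (M : rmodule A) (v : M) :
  linear (fun phi : star_rmod M => vsval phi v : A^c).
Proof. by move=> k f g; rewrite /= add_lfunE scale_lfunE. Qed.

Definition star_eval (M : rmodule A) (v : M) :
    'Hom(star_rmod M, reg_rmod A^c) :=
  lfun_of (@star_eval_linear M v).

Lemma star_evalE (M : rmodule A) (v : M) phi : star_eval v phi = vsval phi v.
Proof. exact: lfun_ofE. Qed.

Lemma star_eval_hom (M : rmodule A) (v : M) :
  star_eval v \in HomA (star_rmod M) (reg_rmod A^c).
Proof. apply/HomAP => phi a; rewrite !star_evalE; exact: star_ractE. Qed.

Section Free.
Variable n : nat.
Local Notation F := (free_rmod A n).

Fact free_coord_linear (i : 'I_n) :
  linear (fun u : F => (u : {ffun _ -> A}) i : reg_rmod A).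
Proof. by move=> k u v; rewrite !ffunE. Qed.

Lemma free_coord_hom i : lfun_of (free_coord_linear i) \in HomA F (reg_rmod A).
Proof. by apply/HomAP => u a; rewrite !lfun_ofE ffunE. Qed.

Definition free_coord i : star_rmod F := Subvs (free_coord_hom i).

Lemma free_coordE i u : vsval (free_coord i) u = (u : {ffun _ -> A}) i.
Proof. exact: lfun_ofE. Qed.

Lemma free_torsionless (v : F) :
  (forall phi : star_rmod F, vsval phi v = 0) -> v = 0.
Proof. by move=> v0; apply/ffunP => i; rewrite -free_coordE v0 ffunE. Qed.

(** The coordinates generate the dual of a free module, so a functional on the
dual is determined by its values on them, and these are the coordinates of w. *)
Lemma free_reflexive (xi : 'Hom(star_rmod F, reg_rmod A^c)) :
    xi \in HomA _ (reg_rmod A^c) ->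
  exists w : F, forall phi, xi phi = vsval phi w.
Proof.
move=> /HomAP xiH; exists ([ffun i => xi (free_coord i) : A] : F) => phi.
pose e (i : 'I_n) : F := [ffun j => (j == i)%:R].
have uE (u : F) : u = \sum_(i < n) e i |* (u : {ffun _ -> A}) i.
  apply/ffunP => j; rewrite sum_ffunE (bigD1 j) //= !ffunE eqxx mul1r.
  by rewrite big1 ?addr0 // => i /negPf ij; rewrite !ffunE eq_sym ij mul0r.
have phiE (u : F) :
    vsval phi u = \sum_(i < n) (vsval phi (e i) : A) * (u : {ffun _ -> A}) i.
  rewrite {1}[u]uE linear_sum; apply: eq_bigr => i _.
  by have /HomAP phiH := subvsP phi; rewrite /= phiH.
have -> : phi = \sum_(i < n) free_coord i |* (vsval phi (e i) : A^c).
  apply/val_inj/lfunP => u; rewrite /= phiE linear_sum sum_lfunE.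
  apply: eq_bigr => i _; rewrite -free_coordE.
  exact/esym/(star_ractE (free_coord i)).
rewrite !linear_sum sum_lfunE; apply: eq_bigr => i _.
rewrite [LHS]xiH; apply: esym; apply: etrans (star_ractE (free_coord i) _ _) _.
by rewrite free_coordE ffunE.
Qed.

End Free.

Lemma star_dE (M : rmodule A) (phi : star_rmod (res M 0)) x :
  vsval (star_d M phi) x = vsval phi (res_d M 0 x).
Proof. by rewrite lfunE star_d_funE. Qed.

(** The first half of the Auslander-Bridger sequence. Lift x to v in the free
module F_0. If all maps M -> A kill x, evaluation at v on F_0^* vanishes on the
maps that factor through M, so it descends to the image of F_0^* in F_1^*. As
Ext^1(Tr M, A) = 0, it extends to F_1^*, where it is evaluation at some w in F_1.
Then v and d w agree under all maps F_0 -> A, so v = d w and x = 0. *)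
Lemma torsionless_of_ext1_transpose (M : rmodule A) :
    ext1_zero (transpose M) (reg_rmod A^c) ->
  forall x : M,
    (forall f, f \in HomA M (reg_rmod A) -> f x = 0) -> x = 0.
Proof.
move=> E1 x x0.
(* d is the map F_0^* -> F_1^* with codomain cut down to the kernel of q. *)
pose q := quot_proj (limg (star_d M)).
have qH : q \in HomA _ (transpose M) by exact: quot_proj_hom.
have q_onto : limg q = fullv := limg_quot_proj _.
have jq := ker_short_exact qH q_onto.
have [phi|d dH dE] := short_exact_lift jq (star_d_hom M).
  by apply/eqP; rewrite quot_proj_eq0 memv_img ?memvf.
have d_onto : limg d = fullv.
  apply/vspaceP => y; rewrite memvf.
  have : ker_incl qH y \in limg (star_d M).
    by have := subvsP y; rewrite memv_ker quot_proj_eq0 lfunE.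
  move=> /memv_imgP[phi _ yE]; apply/memv_imgP; exists phi; rewrite ?memvf //.
  by have [_ j0 _ _] := jq; apply: (lker0_inj j0); rewrite dE.
have /memv_imgP[v _ xE]: x \in limg (cover M) by rewrite cover_onto memvf.
have [phi d0|f fH fE] := hom_factor dH d_onto (star_eval_hom v).
  rewrite star_evalE.
  have phi_d w : vsval phi (res_d M 0 w) = 0.
    have sd0 : star_d M phi = 0 by rewrite -dE d0 linear0.
    by rewrite -star_dE sd0 zero_lfunE.
  have [z|h hH hE] := hom_factor (cover_hom M) (cover_onto M) (subvsP phi).
    by move=> /eqP; rewrite -memv_ker -res_exact0 => /memv_imgP[w _ ->].
  by rewrite -hE -xE x0.
have [g gH gE] := ext1_zero_extend qH q_onto E1 jq fH.
have [w wE] := free_reflexive gH.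
have vE : v - res_d M 0 w = 0.
  apply: free_torsionless => phi; rewrite linearB /=.
  have := gE (d phi); rewrite fE dE wE star_evalE star_dE => <-.
  by rewrite subrr.
rewrite xE; apply/eqP; rewrite -memv_ker -res_exact0.
by rewrite -[v](subrK (res_d M 0 w)) vE add0r memv_img ?memvf.
Qed.

End Torsionless.

(** * Linear functionals *)

Section Functionals.
Variables (K : fieldType) (V : vectType K).

Fact coord_functional_linear (i : 'I_(\dim {:V})) :
  linear (fun v : V => coord (vbasis {:V}) i v : K^o).
Proof. by move=> k u v; rewrite linearP. Qed.

(** A coordinate of the projection along W onto a complement will do. *)
Lemma functional_separates (W : {vspace V}) h :
    h \notin W ->
  exists2 x : 'Hom(V, K^o), forall w, w \in W -> x w = 0 & x h != 0.
Proof.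
move=> hW; set q := daddv_pi W^C W.
have cW : (W^C :&: W = 0)%VS by rewrite capvC capv_compl.
have qW w : w \in W -> q w = 0.
  move=> wW; have := daddv_pi_add cW (_ : w \in W^C + W)%VS.
  rewrite addvC addv_complf memvf => /(_ isT) /eqP.
  rewrite [daddv_pi W _ _]daddv_pi_id ?capv_compl // -subr_eq0 addrK.
  by move=> /eqP.
have qh : q h != 0.
  apply: contraNneq hW => qh.
  have := daddv_pi_add cW (_ : h \in W^C + W)%VS.
  rewrite addvC addv_complf memvf => /(_ isT) <-.
  by rewrite -/q qh add0r memv_pi.
have [i ci] : exists i, coord (vbasis {:V}) i (q h) != 0.
  apply/existsP; apply: contraNT qh; rewrite negb_exists => /forallP c0.
  rewrite (coord_vbasis (memvf (q h))) big1 // => i _.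
  by have /negPn/eqP -> := c0 i; rewrite scale0r.
exists (lfun_of (coord_functional_linear i) \o q)%VF.
  by move=> w wW; rewrite comp_lfunE qW // linear0.
by rewrite comp_lfunE lfun_ofE.
Qed.

Lemma bidual_eval (Xi : 'Hom('Hom(V, K^o), K^o)) :
  exists t : V, forall eta : 'Hom(V, K^o), Xi eta = eta t.
Proof.
pose c i := lfun_of (coord_functional_linear i).
exists (\sum_(i < \dim {:V}) (Xi (c i) : K) *: (vbasis {:V})`_i) => eta.
have {1}-> : eta = \sum_(i < \dim {:V}) (eta (vbasis {:V})`_i : K) *: c i.
  apply/lfunP => v; rewrite {1}(coord_vbasis (memvf v)) linear_sum sum_lfunE.
  by apply: eq_bigr => i _; rewrite scale_lfunE lfun_ofE linearZ /= [LHS]mulrC.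
rewrite !linear_sum; apply: eq_bigr => i _.
by rewrite !linearZ /= [LHS]mulrC.
Qed.

End Functionals.

(** * Coinduced modules and cosyzygies *)

Section Coinduced.
Variables (K : fieldType) (A : falgType K) (L : rmodule A).

(** Hom_K(A, L) with (f a)(b) = f (a b). *)
Definition coind_act (f : 'Hom(A, L)) (a : A) : 'Hom(A, L) := (f \o amull a)%VF.
Fact coind_act_linearl a : linear (coind_act^~ a).
Proof. by move=> k f g; rewrite /coind_act comp_lfunDl comp_lfunZl. Qed.
Fact coind_act_linearr f : linear (coind_act f).
Proof. by move=> k a b; rewrite /coind_act linearP comp_lfunDr comp_lfunZr. Qed.
Fact coind_act1 f : coind_act f 1 = f.
Proof. by rewrite /coind_act amull1 comp_lfun1r. Qed.
Fact coind_actM f a b : coind_act f (a * b) = coind_act (coind_act f a) b.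
Proof. by apply/lfunP => x; rewrite !comp_lfunE !lfunE /= mulrA. Qed.

Definition coind : rmodule A :=
  RModule coind_act_linearl coind_act_linearr coind_act1 coind_actM.

Lemma coind_actE (f : coind) a b :
  (f |* a : 'Hom(A, L)) b = (f : 'Hom(A, L)) (a * b).
Proof. by rewrite comp_lfunE lfunE. Qed.

(** An A-map into Hom_K(A, L) is the same as a K-linear map into L, by evaluation
at 1, and linear maps extend from subspaces. *)
Lemma coind_injective : injective_mod coind.
Proof.
move=> Y Z j f /HomAP jH j0 /HomAP fH.
have fl : linear (fun y : Y => (f y : 'Hom(A, L)) 1).
  by move=> k u v; rewrite linearP add_lfunE scale_lfunE.
pose e : 'Hom(Z, L) := (lfun_of fl \o j^-1)%VF.
have eE y : e (j y) = (f y : 'Hom(A, L)) 1.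
  by rewrite comp_lfunE lker0_lfunK ?j0 // lfun_ofE.
have gl1 z : linear (fun a : A => e (z |* a)).
  by move=> k a b; rewrite ractDr ractZr linearP.
have gl : linear (fun z : Z => lfun_of (gl1 z) : coind).
  move=> k u v; apply/lfunP => a; rewrite add_lfunE scale_lfunE !lfun_ofE.
  by rewrite ractDl ractZl linearP.
exists (lfun_of gl).
  apply/HomAP => z a; apply/lfunP => b.
  by rewrite [LHS](_ : _ = e (z |* a |* b)) ?lfun_ofE // coind_actE !lfun_ofE ractM.
move=> y; apply/lfunP => a; rewrite !lfun_ofE -jH eE fH.
by rewrite coind_actE mulr1.
Qed.

Fact coind_emb_linear1 (m : L) : linear (fun a : A => m |* a).
Proof. by move=> k a b; rewrite ractDr ractZr. Qed.
Fact coind_emb_linear : linear (fun m : L => lfun_of (coind_emb_linear1 m) : coind).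
Proof.
move=> k u v; apply/lfunP => a; rewrite add_lfunE scale_lfunE !lfun_ofE.
by rewrite ractDl ractZl.
Qed.
Definition coind_emb : 'Hom(L, coind) := lfun_of coind_emb_linear.

Lemma coind_embE m a : (coind_emb m : 'Hom(A, L)) a = m |* a.
Proof. by rewrite !lfun_ofE. Qed.

Lemma coind_emb_hom : coind_emb \in HomA L coind.
Proof.
apply/HomAP => m a; apply/lfunP => b.
by rewrite coind_actE !coind_embE ractM.
Qed.

(** I(L) / L, for L embedded in I(L) = Hom_K(A, L) by m |-> (a |-> m a). *)
Definition cosyzygy : rmodule A := quot_rmod (limg_submod coind_emb_hom).
Definition coind_proj : 'Hom(coind, cosyzygy) := quot_proj (limg coind_emb).

Lemma cosyz_short_exact : short_exact coind_emb coind_proj.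
Proof.
split.
- split; [exact: coind_emb_hom | exact: quot_proj_hom].
- apply/eqP/lker0P => m m' /(congr1 (fun f : 'Hom(A, L) => f 1)).
  by rewrite !coind_embE !ract1.
- exact/esym/lker_quot_proj.
- exact: limg_quot_proj.
Qed.

Lemma ext1_zero_cosyzygy Z : ext1_zero Z cosyzygy <-> ext1_zero (syzygy Z) L.
Proof. exact: ext1_zero_shift cosyz_short_exact coind_injective Z. Qed.

Lemma ext1_zero_coind_proj Z : ext1_zero Z L <-> lifts coind_proj Z.
Proof. exact: ext1_zero_lifts cosyz_short_exact coind_injective Z. Qed.

End Coinduced.

Section CosyzygyIterate.
Variables (K : fieldType) (A : falgType K).

Lemma ext1_zero_iter_cosyzygy i j (Z L : rmodule A) :
  ext1_zero (iter i (@syzygy K A) Z) (iter j (@cosyzygy K A) L) <->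
  ext1_zero (iter (j + i) (@syzygy K A) Z) L.
Proof.
elim: j i => [//|j IHj] i.
apply: iff_trans (ext1_zero_cosyzygy _ _) _.
by rewrite addSnnS; exact: IHj i.+1.
Qed.

End CosyzygyIterate.

(** * Lifting from the regular module and from direct sums *)

Section LiftsSums.
Variables (K : fieldType) (A : falgType K) (I C : rmodule A).
Variable p : 'Hom(I, C).
Hypotheses (pH : p \in HomA I C) (p_onto : limg p = fullv).

Lemma lifts_reg : lifts p (reg_rmod A).
Proof.
have /HomAP pL := pH; move=> f /HomAP fH.
have /memv_imgP[x _ xE] : f (1 : A) \in limg p by rewrite p_onto memvf.
have gl : linear (fun a : reg_rmod A => x |* (a : A)).
  by move=> k a b; rewrite ractDr ractZr.
have gE a : lfun_of gl a = x |* (a : A) by rewrite lfun_ofE.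
exists (lfun_of gl).
  by apply/HomAP => a b; rewrite !gE -ractM.
by move=> a; rewrite gE pL -xE -fH /= mul1r.
Qed.

Lemma lifts_dsum (Y Z : rmodule A) : lifts p Y -> lifts p Z -> lifts p (dsum Y Z).
Proof.
move=> lY lZ f /HomAP fH.
have fl1 : linear (fun y : Y => f ((y, 0) : dsum Y Z)).
  move=> k u v; rewrite -linearP /=; congr (f _).
  by apply/pair_equal_spec; rewrite /= scaler0 addr0.
have fl2 : linear (fun z : Z => f ((0, z) : dsum Y Z)).
  move=> k u v; rewrite -linearP /=; congr (f _).
  by apply/pair_equal_spec; rewrite /= scaler0 addr0.
have act0 (W : rmodule A) a : (0 : W) |* a = 0 by rewrite -ractlE linear0.
have f1H : lfun_of fl1 \in HomA Y C.
  by apply/HomAP => y a; rewrite !lfun_ofE -fH; congr (f (_, _)); rewrite act0.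
have f2H : lfun_of fl2 \in HomA Z C.
  by apply/HomAP => y a; rewrite !lfun_ofE -fH; congr (f (_, _)); rewrite act0.
have [g1 /HomAP g1H g1E] := lY _ f1H.
have [g2 /HomAP g2H g2E] := lZ _ f2H.
have gl : linear (fun w : dsum Y Z => g1 w.1 + g2 w.2).
  by move=> k u v; rewrite /= !linearP scalerDr addrACA.
exists (lfun_of gl).
  by apply/HomAP => w a; rewrite !lfun_ofE /= ractDl g1H g2H.
move=> [y z]; rewrite lfun_ofE linearD /= g1E g2E !lfun_ofE -linearD.
by congr (f _); apply/pair_equal_spec; rewrite /= addr0 add0r.
Qed.

Lemma lifts_dsumr (Y Z : rmodule A) : lifts p (dsum Y Z) -> lifts p Z.
Proof.
move=> lYZ f /HomAP fH.
have fl : linear (fun w : dsum Y Z => f w.2) by move=> k u v; rewrite /= linearP.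
have fsH : lfun_of fl \in HomA (dsum Y Z) C.
  by apply/HomAP => w a; rewrite !lfun_ofE /= fH.
have [g /HomAP gH gE] := lYZ _ fsH.
have jl : linear (fun z : Z => (0, z) : dsum Y Z).
  by move=> k u v; apply/pair_equal_spec; split; rewrite //= scaler0 addr0.
have jH : lfun_of jl \in HomA Z (dsum Y Z).
  apply/HomAP => z a; rewrite !lfun_ofE.
  by apply/pair_equal_spec; split; rewrite //= -ractlE linear0.
exists (g \o lfun_of jl)%VF.
  by apply: HomA_comp jH; apply/HomAP.
by move=> z; rewrite comp_lfunE gE !lfun_ofE.
Qed.

End LiftsSums.

(** * The functor Hom_A(N, -) *)

Section HomFunctor.
Variables (K : fieldType) (A : falgType K) (N : rmodule A).
Variable N_neq0 : ({:N} != 0)%VS.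
Local Notation B := (endo_algebra N_neq0).

Section HomModule.
Variable L : rmodule A.

(** Hom_A(N, L) as a right module over End_A(N), which acts by composition. *)
Definition hom_act (f : subvs_of (HomA N L)) (b : B) : subvs_of (HomA N L) :=
  Subvs (HomA_comp (subvsP f) (subvsP (b : endo N_neq0))).

Lemma hom_act_val f b n : vsval (hom_act f b) n = vsval f (vsval (b : endo N_neq0) n).
Proof. exact: comp_lfunE. Qed.

Fact hom_act_linearl b : linear (hom_act^~ b).
Proof. by move=> k f g; apply/val_inj; rewrite /= comp_lfunDl comp_lfunZl. Qed.
Fact hom_act_linearr f : linear (hom_act f).
Proof. by move=> k b c; apply/val_inj; rewrite /= comp_lfunDr comp_lfunZr. Qed.
Fact hom_act1 f : hom_act f 1 = f.
Proof. exact/val_inj/comp_lfun1r. Qed.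
Fact hom_actM f b c : hom_act f (b * c) = hom_act (hom_act f b) c.
Proof. exact/val_inj/comp_lfunA. Qed.

Definition hom_rmod : rmodule B :=
  RModule hom_act_linearl hom_act_linearr hom_act1 hom_actM.

End HomModule.

Section HomMap.
Variables (L C : rmodule A) (p : 'Hom(L, C)) (pH : p \in HomA L C).

Fact hom_map_linear :
  linear (fun f : hom_rmod L => Subvs (HomA_comp pH (subvsP f)) : hom_rmod C).
Proof. by move=> k f g; apply/val_inj; rewrite /= comp_lfunDr comp_lfunZr. Qed.

Definition hom_map : 'Hom(hom_rmod L, hom_rmod C) := lfun_of hom_map_linear.

Lemma hom_mapE f n : vsval (hom_map f) n = p (vsval f n).
Proof. by rewrite lfun_ofE comp_lfunE. Qed.

Lemma hom_map_hom : hom_map \in HomA (hom_rmod L) (hom_rmod C).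
Proof.
apply/HomAP => f b; apply/val_inj/lfunP => n.
by rewrite /= hom_act_val !hom_mapE hom_act_val.
Qed.

End HomMap.

Lemma hom_short_exact (L I C : rmodule A) (i : 'Hom(L, I)) (p : 'Hom(I, C))
    (iH : i \in HomA L I) (pH : p \in HomA I C) :
  short_exact i p -> lifts p N -> short_exact (hom_map iH) (hom_map pH).
Proof.
move=> ip lp; have [_ i0 ipE p_onto] := ip.
split; [by split; exact: hom_map_hom | | |].
- apply/eqP/lker0P => f g fg; apply/val_inj/lfunP => n.
  by apply: (lker0_inj i0); rewrite -!(hom_mapE iH) fg.
- apply/vspaceP => f; rewrite memv_ker; apply/memv_imgP/eqP => [[g _ ->]|pf].
    apply/val_inj/lfunP => n; rewrite !hom_mapE zero_lfunE.
    by apply/eqP; rewrite -memv_ker -ipE memv_img ?memvf.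
  have [n|g gH gE] := short_exact_lift ip (subvsP f).
    by rewrite -(hom_mapE pH) pf zero_lfunE.
  exists (Subvs gH : hom_rmod L); rewrite ?memvf //.
  by apply/val_inj/lfunP => n; rewrite hom_mapE gE.
apply/vspaceP => f; rewrite memvf; have [g gH gE] := lp _ (subvsP f).
apply/memv_imgP; exists (Subvs gH : hom_rmod I); rewrite ?memvf //.
by apply/val_inj/lfunP => n; rewrite hom_mapE gE.
Qed.

End HomFunctor.

(** * Modules over the endomorphism algebra of A + X *)

Section Generator.
Variables (K : fieldType) (A : falgType K) (X : rmodule A).
Local Notation N := (dsum (reg_rmod A) X).
Local Notation E := (endo (dsum_reg_neq0 X)).
Local Notation B := (endo_algebra (dsum_reg_neq0 X)).
Local Notation HomN := (hom_rmod (dsum_reg_neq0 X)).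
Local Notation ev b := (vsval (b : E)).

(** The endomorphism (a, x) |-> n a. These form the left ideal Be, where e is the
projection of N onto A: Be is isomorphic to Hom_A(A, N) = N. *)
Fact from_reg_map_linear (n : N) : linear (fun w : N => n |* (w.1 : A)).
Proof. by move=> k u v; exact: ract_linearr. Qed.

Fact from_reg_map_hom n : lfun_of (from_reg_map_linear n) \in HomA N N.
Proof. by apply/HomAP => w a; rewrite !lfun_ofE -ractM. Qed.

Definition from_reg (n : N) : B := Subvs (from_reg_map_hom n) : E.

Lemma from_regE n w : ev (from_reg n) w = n |* (w.1 : A).
Proof. exact: lfun_ofE. Qed.

(** The endomorphism w |-> (s w, 0), for s in Hom_A(N, A). These form the right
ideal eB. *)
Fact into_reg_map_linear (s : star_rmod N) :
  linear (fun w : N => ((vsval s w : reg_rmod A), 0) : N).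
Proof.
move=> k u v; rewrite linearP; apply/pair_equal_spec; split=> //=.
by rewrite scaler0 addr0.
Qed.

Fact into_reg_map_hom s : lfun_of (into_reg_map_linear s) \in HomA N N.
Proof.
have /HomAP sH := subvsP s.
apply/HomAP => w a; rewrite !lfun_ofE sH; apply/pair_equal_spec; split=> //=.
by rewrite -ractlE linear0.
Qed.

Definition into_reg (s : star_rmod N) : B := Subvs (into_reg_map_hom s) : E.

Lemma into_regE s w : ev (into_reg s) w = (vsval s w, 0).
Proof. exact: lfun_ofE. Qed.

Fact reg_part_linear (b : B) : linear (fun w : N => (ev b w).1 : reg_rmod A).
Proof. by move=> k u v; rewrite linearP. Qed.

Fact reg_part_hom (b : B) :
  lfun_of (reg_part_linear b) \in HomA N (reg_rmod A).
Proof.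
have /HomAP bH := subvsP (b : E).
by apply/HomAP => w a; rewrite !lfun_ofE bH.
Qed.

Definition reg_part (b : B) : star_rmod N := Subvs (reg_part_hom b).

Lemma reg_partE b w : vsval (reg_part b) w = (ev b w).1.
Proof. exact: lfun_ofE. Qed.

Lemma endoP (b c : B) : (forall n, ev b n = ev c n) -> b = c.
Proof. by move=> bc; apply/val_inj/lfunP. Qed.

Lemma endoME (b c : B) n : ev (b * c) n = ev b (ev c n).
Proof. exact: comp_lfunE. Qed.

Lemma endo_ract (b : B) n a : ev b (n |* a) = ev b n |* a.
Proof. by have /HomAP bH := subvsP (b : E); apply: bH. Qed.

Lemma from_reg_linear : linear from_reg.
Proof.
move=> k m n; apply: endoP => w.
rewrite [LHS]from_regE; apply: etrans (ract_linearl (w.1 : A) k m n) _.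
by rewrite add_lfunE scale_lfunE !from_regE.
Qed.

Lemma into_reg_linear : linear into_reg.
Proof.
move=> k f g; apply: endoP => w.
rewrite [LHS]into_regE /= !(add_lfunE, scale_lfunE) !lfun_ofE.
by apply/pair_equal_spec; split=> //=; rewrite scaler0 addr0.
Qed.

Lemma from_reg_mul b n : b * from_reg n = from_reg (ev b n).
Proof. by apply: endoP => w; rewrite endoME !from_regE endo_ract. Qed.

Definition unit_vec : N := (1, 0).

Lemma hom_ractE L (f : HomN L) b n : vsval (f |* b) n = vsval f (ev b n).
Proof. exact: hom_act_val. Qed.

Lemma hom_rmodP L (f : HomN L) n a : vsval f (n |* a) = vsval f n |* a.
Proof. by have /HomAP fH := subvsP f; apply: fH. Qed.

Lemma hom_from_reg_unit L (f : HomN L) n : vsval (f |* from_reg n) unit_vec = vsval f n.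
Proof. by rewrite hom_ractE from_regE ract1. Qed.

(** B-maps Y -> Hom_A(N, Hom_K(A, L)) are the same as K-linear maps Ye -> L, for e
the projection of N onto A, and linear maps extend from subspaces. Explicitly,
f is recovered from its values at unit_vec and 1 by letting the elements
[from_reg n] of Be act on y. *)
Lemma hom_coind_injective L : injective_mod (HomN (coind L)).
Proof.
move=> Y Z j f /HomAP jH j0 /HomAP fH.
have fl : linear (fun y : Y => (vsval (f y) unit_vec : 'Hom(A, L)) 1).
  by move=> k u v; rewrite linearP /= !(add_lfunE, scale_lfunE).
pose e : 'Hom(Z, L) := (lfun_of fl \o j^-1)%VF.
have eE y : e (j y) = (vsval (f y) unit_vec : 'Hom(A, L)) 1.
  by rewrite comp_lfunE lker0_lfunK ?j0 // lfun_ofE.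
have gl1 z n : linear (fun a : A => e (z |* from_reg (n |* a))).
  by move=> k a b; rewrite ractDr ractZr from_reg_linear ractDr ractZr linearP.
have gl2 z : linear (fun n : N => lfun_of (gl1 z n) : coind L).
  move=> k u v; apply/lfunP => a; rewrite add_lfunE scale_lfunE !lfun_ofE.
  by rewrite ractDl ractZl from_reg_linear ractDr ractZr linearP.
have gH2 z : lfun_of (gl2 z) \in HomA N (coind L).
  apply/HomAP => n a; apply/lfunP => b.
  by rewrite coind_actE !lfun_ofE ractM.
have gl : linear (fun z : Z => Subvs (gH2 z) : HomN (coind L)).
  move=> k u v; apply/val_inj/lfunP => n; apply/lfunP => a.
  by rewrite /= !(add_lfunE, scale_lfunE) !lfun_ofE ractDl ractZl linearP.
have gE z n a : (vsval (lfun_of gl z) n : 'Hom(A, L)) a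
    = e (z |* from_reg (n |* a)) by rewrite !lfun_ofE.
exists (lfun_of gl).
  apply/HomAP => z b; apply/val_inj/lfunP => n; apply/lfunP => a.
  by rewrite gE -ractM from_reg_mul hom_ractE gE endo_ract.
move=> y; apply/val_inj/lfunP => n; apply/lfunP => a.
rewrite gE -jH eE fH hom_from_reg_unit hom_rmodP.
by rewrite coind_actE mulr1.
Qed.

(** * Consequences of a symmetrizing form *)

Section Symmetric.
Variable tr : 'Hom(A, K^o).
Hypothesis tr_sym : forall x y, tr (x * y) = tr (y * x).
Hypothesis tr_nondeg : forall x, (forall y, tr (x * y) = 0) -> x = 0.
Hypothesis tr_repr : forall eta : 'Hom(A, K^o),
  exists x, forall y, tr (x * y) = eta y.

(** Composition with the symmetrizing form identifies Hom_A(M, A) with D(M). *)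
Lemma form_lift (M : rmodule A) (eta : 'Hom(M, K^o)) :
  exists2 s : 'Hom(M, reg_rmod A), s \in HomA M (reg_rmod A)
    & forall m, tr (s m) = eta m.
Proof.
have tl (x : A) : linear (fun y : A => tr (x * y)).
  by move=> k y z; rewrite mulrDr -scalerAr linearP.
have Tl : linear (fun x : A => lfun_of (tl x)).
  move=> k y z; apply/lfunP => w; rewrite add_lfunE scale_lfunE !lfun_ofE.
  by rewrite mulrDl -scalerAl linearP.
pose T := lfun_of Tl.
have TE x y : T x y = tr (x * y) by rewrite !lfun_ofE.
have T0 : lker T == 0%VS.
  apply/lker0P => x y Txy; apply/eqP; rewrite -subr_eq0; apply/eqP/tr_nondeg => z.
  by rewrite mulrBl linearB /= -!TE Txy subrr.
have T_onto f : f \in limg T.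
  have [x xE] := tr_repr f; apply/memv_imgP; exists x; rewrite ?memvf //.
  by apply/lfunP => y; rewrite TE xE.
have el1 m : linear (fun a : A => eta (m |* a)).
  by move=> k a b; rewrite ractDr ractZr linearP.
have el : linear (fun m : M => lfun_of (el1 m)).
  move=> k a b; apply/lfunP => c; rewrite add_lfunE scale_lfunE !lfun_ofE.
  by rewrite ractDl ractZl linearP.
pose s : 'Hom(M, reg_rmod A) := (T^-1 \o lfun_of el)%VF.
have sE m a : tr ((s m : A) * a) = eta (m |* a).
  by rewrite -TE comp_lfunE limg_lfunVK ?T_onto // !lfun_ofE.
exists s; last by move=> m; rewrite -[s m]mulr1 sE ract1.
apply/HomAP => m a; apply/(lker0P T0)/lfunP => b.
by rewrite !TE sE -mulrA sE ractM.
Qed.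

Lemma form_separates (M : rmodule A) (m : M) : m != 0 ->
  exists2 s : 'Hom(M, reg_rmod A), s \in HomA M (reg_rmod A) & s m != 0.
Proof.
rewrite -memv0 => /functional_separates[eta _ etam].
have [s sH sE] := form_lift eta; exists s => //.
by apply: contraNneq etam => sm; rewrite -sE sm linear0.
Qed.

(** So M is the K-dual of Hom_A(M, A). *)
Lemma form_represents (M : rmodule A) (Psi : 'Hom(star_rmod M, K^o)) :
  exists t : M, forall s, Psi s = tr (vsval s t).
Proof.
have Tl : linear (fun s : star_rmod M => (tr \o vsval s)%VF : 'Hom(M, K^o)).
  by move=> k f g; rewrite /= comp_lfunDr comp_lfunZr.
pose T := lfun_of Tl.
have TE s m : T s m = tr (vsval s m) by rewrite lfun_ofE comp_lfunE.
have T0 : lker T == 0%VS.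
  apply/lker0P => f g Tfg; apply/val_inj/lfunP => m.
  apply/eqP; rewrite -subr_eq0; apply/eqP/tr_nondeg => a.
  have /HomAP fH := subvsP f; have /HomAP gH := subvsP g.
  rewrite mulrBl linearB /=; have := congr1 (fun h : 'Hom(M, K^o) => h (m |* a)) Tfg.
  by rewrite !TE fH gH => ->; rewrite subrr.
have [t tE] := bidual_eval (Psi \o T^-1)%VF.
by exists t => s; rewrite -TE -tE comp_lfunE lker0_lfunK.
Qed.

(** The isomorphism from N to D(Hom_A(N, A)) = D(eB) = D(B)e, seen as an embedding
of N in D(B). *)
Fact dual_emb_linear1 (n : N) : linear (fun b : B => tr (ev b n).1).
Proof. by move=> k b c; rewrite /= add_lfunE scale_lfunE linearP. Qed.

Fact dual_emb_linear :
  linear (fun n : N => lfun_of (dual_emb_linear1 n) : dual_reg_rmod B).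
Proof.
move=> k m n; apply/lfunP => b; rewrite add_lfunE scale_lfunE !lfun_ofE.
by rewrite linearP /= linearP.
Qed.

Definition dual_emb : 'Hom(N, dual_reg_rmod B) := lfun_of dual_emb_linear.

Lemma dual_embE n b : (dual_emb n : 'Hom(B, K^o)) b = tr (ev b n).1.
Proof. by rewrite !lfun_ofE. Qed.

Lemma dual_ractE (psi : dual_reg_rmod B) b c :
  (psi |* b : 'Hom(B, K^o)) c = (psi : 'Hom(B, K^o)) (b * c).
Proof. by rewrite comp_lfunE lfunE. Qed.

Lemma dual_emb_inj : lker dual_emb == 0%VS.
Proof.
apply/lker0P => m n mn; apply/eqP; rewrite -subr_eq0.
apply: contraT => /form_separates[s sH]; rewrite linearB /= => /eqP[].
apply: tr_nondeg => a.
have E w : tr ((s w : A) * a) =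
    (dual_emb w : 'Hom(B, K^o)) (from_reg (unit_vec |* a) * into_reg (Subvs sH)).
  by rewrite dual_embE endoME from_regE into_regE /= mul1r tr_sym.
by rewrite mulrBl linearB /= !E mn subrr.
Qed.

(** The embedding of N is A-linear, where A acts on D(B)e through eBe. *)
Lemma dual_emb_ract t a :
  dual_emb t |* from_reg (unit_vec |* a) = dual_emb (t |* a).
Proof.
apply/lfunP => y; rewrite dual_ractE !dual_embE endoME from_regE endo_ract /=.
by rewrite mul1r tr_sym.
Qed.

(** D(B)e lies in the image of N: psi times an element of Be is a functional on
eB = Hom_A(N, A), hence evaluation at an element of N. *)
Lemma ract_from_reg_dual_emb (psi : dual_reg_rmod B) n :
  psi |* from_reg n \in limg dual_emb.
Proof.
have Psil : linear (fun s : star_rmod N =>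
    (psi : 'Hom(B, K^o)) (from_reg n * into_reg s)).
  by move=> k f g; rewrite into_reg_linear mulrDr -scalerAr linearP.
have [t tE] := form_represents (lfun_of Psil).
apply/memv_imgP; exists t; rewrite ?memvf //; apply/lfunP => y.
rewrite dual_ractE dual_embE.
have := tE (reg_part y); rewrite lfun_ofE reg_partE => <-.
congr ((psi : 'Hom(B, K^o)) _); apply: endoP => w.
by rewrite !endoME !from_regE into_regE reg_partE.
Qed.

(** A B-map f from D(B) to Hom_A(N, C) is determined by its restriction to D(B)e,
that is, by the A-map n |-> f (dual_emb n) unit_vec from N to C; a lift of the
latter to I gives back a lift of f. *)
Lemma lifts_dual_reg (I C : rmodule A) (p : 'Hom(I, C)) (pH : p \in HomA I C) :
  lifts p N -> lifts (hom_map (dsum_reg_neq0 X) pH) (dual_reg_rmod B).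
Proof.
move=> lp f /HomAP fH.
have f0l : linear (fun n : N => vsval (f (dual_emb n)) unit_vec).
  by move=> k m n; rewrite !linearP /= add_lfunE scale_lfunE.
have f0E n : lfun_of f0l n = vsval (f (dual_emb n)) unit_vec by apply: lfun_ofE.
have f0H : lfun_of f0l \in HomA N C.
  apply/HomAP => n a; rewrite !f0E -dual_emb_ract fH hom_ractE from_regE.
  by rewrite ract1 hom_rmodP.
have [g0 /HomAP g0H g0E] := lp _ f0H.
pose g (psi : dual_reg_rmod B) (n : N) := g0 (dual_emb^-1%VF (psi |* from_reg n)).
have gl1 psi : linear (g psi).
  by move=> k m n; rewrite /g from_reg_linear ractDr ractZr !linearP.
have gH psi : lfun_of (gl1 psi) \in HomA N I.
  apply/HomAP => n a; rewrite !lfun_ofE /g -g0H; congr (g0 _).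
  have /memv_imgP[t _ tE] := ract_from_reg_dual_emb psi n.
  have -> : from_reg (n |* a) = from_reg n * from_reg (unit_vec |* a).
    by rewrite from_reg_mul from_regE /= mul1r.
  by rewrite ractM tE dual_emb_ract !lker0_lfunK ?dual_emb_inj.
have gl : linear (fun psi => Subvs (gH psi) : HomN I).
  move=> k u v; apply/val_inj/lfunP => n.
  by rewrite /= add_lfunE scale_lfunE !lfun_ofE /g ractDl ractZl !linearP.
have gE psi n : vsval (lfun_of gl psi) n = g psi n by rewrite !lfun_ofE.
exists (lfun_of gl).
  apply/HomAP => psi b; apply/val_inj/lfunP => n.
  by rewrite gE hom_ractE gE /g -ractM from_reg_mul.
move=> psi; apply/val_inj/lfunP => n; rewrite hom_mapE gE g0E f0E.
by rewrite limg_lfunVK ?ract_from_reg_dual_emb // fH hom_from_reg_unit.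
Qed.

End Symmetric.
End Generator.

(** The form is the image of 1 under the bimodule isomorphism. *)
Lemma symmetrizing_form (K : fieldType) (A : falgType K) :
    symmetric_algebra A ->
  exists tr : 'Hom(A, K^o),
    [/\ forall x y, tr (x * y) = tr (y * x),
        forall x, (forall y, tr (x * y) = 0) -> x = 0
      & forall eta : 'Hom(A, K^o), exists x, forall y, tr (x * y) = eta y].
Proof.
move=> [phi [phi0 phi_onto phiE]]; pose tr := phi 1; exists tr.
have phi_l x y : phi x y = tr (x * y).
  by have := phiE 1 1 x y; rewrite !mul1r mulr1.
have phi_r x y : phi x y = tr (y * x).
  by have := phiE x 1 1 y; rewrite !mulr1 mul1r.
split=> [x y|x x0|eta]; first by rewrite -phi_l phi_r.
  apply: (lker0_inj phi0); apply/lfunP => y.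
  by rewrite linear0 zero_lfunE phi_l x0.
have /memv_imgP[x _ ->] : eta \in limg phi by rewrite phi_onto memvf.
by exists x => y; exact: esym (phi_l x y).
Qed.

(** * The module Hom_A(N, C) *)

Section Witness.
Variables (K : fieldType) (A : falgType K) (X : rmodule A).
Hypothesis A_sym : symmetric_algebra A.
Local Notation N := (dsum (reg_rmod A) X).
Local Notation E := (endo (dsum_reg_neq0 X)).
Local Notation B := (endo_algebra (dsum_reg_neq0 X)).
Local Notation HomN := (hom_rmod (dsum_reg_neq0 X)).

(** The induction runs over all L at once: Hom_A(N, -) preserves exactness of
0 -> L -> I(L) -> C(L) -> 0, so a syzygy of D(B) can be traded for the cosyzygy
of L, which satisfies the same hypothesis. *)
Lemma ext1_dual_reg_hom (L : rmodule A) :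
    (forall i, ext1_zero (iter i (@syzygy K A) X) L) ->
  forall i, ext1_zero (iter i (@syzygy K B) (dual_reg_rmod B)) (HomN L).
Proof.
have [tr [tr_sym tr_nondeg tr_repr]] := symmetrizing_form A_sym.
move=> XL i; elim: i L XL => [|i IHi] L XL.
  all: have [[iH pH] _ _ p_onto] := cosyz_short_exact L.
  all: have lpN : lifts (coind_proj L) N
    by apply: lifts_dsum; [exact: lifts_reg | exact/ext1_zero_coind_proj/(XL 0)].
  all: have ipB := hom_short_exact (dsum_reg_neq0 X) iH pH (cosyz_short_exact L) lpN.
  apply: (proj2 (ext1_zero_lifts ipB (@hom_coind_injective _ _ _ _) _)).
  exact: lifts_dual_reg tr_sym tr_nondeg tr_repr _ _ _ _ lpN.
apply: (proj1 (ext1_zero_shift ipB (@hom_coind_injective _ _ _ _) _)).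
by apply: IHi => j; apply/ext1_zero_cosyzygy; exact: XL j.+1.
Qed.

(** If h does not lift, some functional x on Hom_A(N, C) vanishes on the maps that
lift but not on h, and every homomorphism from D(Hom_A(N, C)) to B kills x: its
value at x is annihilated by eB, and Hom_A(N, A) separates the points of N. This
contradicts the torsionlessness of D(Hom_A(N, C)). *)
Lemma lifts_of_gorenstein_injective (I C : rmodule A) (p : 'Hom(I, C)) :
    p \in HomA I C -> limg p = fullv -> gorenstein_injective (HomN C) ->
  lifts p N.
Proof.
have [tr [tr_sym tr_nondeg tr_repr]] := symmetrizing_form A_sym.
move=> pH p_onto [_ /(_ 1 isT) /(Ext_ext1_zero 0) E1] h hH.
pose h' : HomN C := Subvs hH.
have [/memv_imgP[g _ gE]|hW] := boolP (h' \in limg (hom_map (dsum_reg_neq0 X) pH)).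
  exists (vsval g); first exact: subvsP.
  by move=> z; have := hom_mapE pH g z; rewrite -gE => <-.
have [x xW /eqP[]] := functional_separates hW.
have -> : x = 0 :> dual_rmod (HomN C); last by rewrite zero_lfunE.
apply: (torsionless_of_ext1_transpose E1) => th /HomAP thH.
apply: endoP => n; rewrite zero_lfunE; apply/eqP; apply: contraT.
move=> /(form_separates tr_nondeg tr_repr)[s sH /eqP[]].
pose y : B := into_reg (Subvs sH).
have xy : (x : dual_rmod (HomN C)) |* (y : B^c) = 0.
  apply/lfunP => g; rewrite comp_lfunE ractlE zero_lfunE; apply: xW.
  (* g o y factors through A, so it is enough to lift the image of 1 in C. *)
  have /memv_imgP[i _ iE]: vsval g (unit_vec X) \in limg p.
    by rewrite p_onto memvf.
  have rl : linear (fun w : N => i |* (s w : A)).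
    by move=> k u v; rewrite linearP ractDr ractZr.
  have /HomAP sL := sH; have /HomAP pL := pH.
  have rH : lfun_of rl \in HomA N I.
    by apply/HomAP => w a; rewrite !lfun_ofE sL -ractM.
  apply/memv_imgP; exists (Subvs rH : HomN I); rewrite ?memvf //.
  apply/val_inj/lfunP => w; rewrite hom_mapE lfun_ofE pL -iE hom_ractE.
  rewrite into_regE -hom_rmodP; congr (vsval g _).
  by apply/pair_equal_spec; split; rewrite /= ?mul1r // -ractlE linear0.
have yb0 : y * (th x : B) = 0.
  by have := thH (x : dual_rmod (HomN C)) (y : B^c); rewrite xy linear0 => /esym.
have := endoME y (th x : B) n.
by rewrite yb0 zero_lfunE into_regE => /esym /(congr1 fst).
Qed.

End Witness.

Theorem theorem3 (K : fieldType) (A : falgType K)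
    (A_connected : connected_algebra A)
    (A_nonsemisimple : ~ semisimple_algebra A)
    (A_symmetric : symmetric_algebra A)
    (X : rmodule A) (m : nat) (Xs : 'I_m -> rmodule A)
    (Xs_indec : forall i, indecomposable (Xs i))
    (Xs_nonproj : forall i, ~ projective_mod (Xs i))
    (X_sum : mod_iso X (direct_sum Xs))
    (M : rmodule A) (M_indec : indecomposable M)
    (l : nat) (l_ge1 : (1 <= l)%N)
    (Ext_l : Ext l X M <> 0%VS)
    (Ext_gt_l : forall i, (l + 1 <= i)%N -> Ext i X M = 0%VS) :
  ~ weakly_gorenstein (endo_algebra (dsum_reg_neq0 X)).
Proof.
case: l l_ge1 Ext_l Ext_gt_l => [//|k] _ Ext_k Ext_gt_k [_ rwg].
pose L := iter k (@cosyzygy K A) M.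
have L_vanish i : ext1_zero (iter i (@syzygy K A) X) (cosyzygy L).
  apply: (proj2 (ext1_zero_iter_cosyzygy i k.+1 X M)).
  by apply/Ext_ext1_zero/Ext_gt_k; rewrite addn1 addSn ltnS leq_addr.
have G_inj : gorenstein_injective (hom_rmod (dsum_reg_neq0 X) (cosyzygy L)).
  apply: rwg => -[//|i] _; apply/Ext_ext1_zero.
  exact: ext1_dual_reg_hom A_symmetric _ L_vanish i.
have [[_ pH] _ _ p_onto] := cosyz_short_exact L.
have lpN := lifts_of_gorenstein_injective A_symmetric pH p_onto G_inj.
apply/Ext_k/Ext_ext1_zero.
rewrite -[k]addn0; apply/ext1_zero_iter_cosyzygy/ext1_zero_coind_proj.
exact: lifts_dsumr lpN.
Qed.
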